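(* Let $X$ and $Y$ be real normed spaces and let $C\subseteq X$ be a convex cone with $0\in C$. If $\varphi:C\twoheadrightarrow Y$ is a sublinear correspondence such that $\varphi(x)$ is a bounded subset of $Y$ for every $x\in C$, then $\varphi$ is upper semicontinuous at zero if and only if $\varphi$ is bounded.
   Context: A subset $C$ of a real normed space $X$ is a cone if $tC\subseteq C$ for every $t>0$. A correspondence $\varphi:C\twoheadrightarrow Y$ assigns to each $x\in C$ a nonempty subset $\varphi(x)\subseteq Y$; for $E\subseteq C$, $\varphi(E)=\bigcup_{x\in E}\varphi(x)$. It is sublinear if $\varphi(x+y)\subseteq\varphi(x)+\varphi(y)$ and $\varphi(\lambda x)=\lambda\varphi(x)$ for all $x,y\in C$ and $\lambda>0$. It is bounded if $\varphi(E)$ is bounded in $Y$ for every bounded subset $E$ of $C$. It is upper semicontinuous at $x\in C$ if for every neighborhood $U$ of the set $\varphi(x)$ (i.e. $U$ contains an open set containing $\varphi(x)$) there is a neighborhood $V$ of $x$ in $C$ such that $\varphi(z)\subseteq U$ for all $z\in V$. *)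

(* Defs.v *)
From mathcomp Require Import all_boot all_order all_algebra.
From mathcomp Require Import all_classical all_reals all_analysis.

Set Implicit Arguments.
Unset Strict Implicit.
Unset Printing Implicit Defensive.

Import GRing.Theory numFieldNormedType.Exports.
Local Open Scope classical_set_scope.
Local Open Scope ring_scope.

Definition cone (R : realType) (X : normedModType R) (C : set X) : Prop :=
  forall t : R, 0 < t -> [set t *: x | x in C] `<=` C.

(* A correspondence from C to Y is a total map X -> set Y with nonempty values
   on C. The definitions below use its values at points of C only. *)
Definition correspondence (R : realType) (X Y : normedModType R)
    (C : set X) (phi : X -> set Y) : Prop :=
  forall x, C x -> phi x !=set0.

Definition sublinear (R : realType) (X Y : normedModType R)
    (C : set X) (phi : X -> set Y) : Prop :=
  (forall x y, C x -> C y ->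
     phi (x + y) `<=` [set u + v | u in phi x & v in phi y]) /\
  (forall (x : X) (l : R), C x -> 0 < l ->
     phi (l *: x) = [set l *: u | u in phi x]).

Definition bounded_correspondence (R : realType) (X Y : normedModType R)
    (C : set X) (phi : X -> set Y) : Prop :=
  forall E : set X, E `<=` C -> bounded_set E ->
    bounded_set (\bigcup_(x in E) phi x).

(* The neighborhoods of x in C are those of the subspace topology, given by
   the filter [within C (nbhs x)]. *)
Definition upper_semicontinuous_at (R : realType) (X Y : normedModType R)
    (C : set X) (phi : X -> set Y) (x : X) : Prop :=
  forall U : set Y,
    (exists O : set Y, [/\ open O, phi x `<=` O & O `<=` U]) ->
    \forall z \near within C (nbhs x), phi z `<=` U.

(* Main.v *)
Require Import Defs.
From mathcomp Require Import all_boot all_order all_algebra.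
From mathcomp Require Import all_classical all_reals all_analysis.

(** Positive homogeneity drives the proof.  Since [phi 0 = l *: phi 0] for
    every [l > 0], the nonempty bounded set [phi 0] reduces to the origin
    ([homogeneous_at0]), so that the neighborhoods of [phi 0] are those of the
    origin.  As for linear maps, homogeneity moreover turns a bound on the
    values of [phi] over one ball of [C] into a proportional bound over every
    ball ([homogeneous_bound]).  Upper semicontinuity at zero bounds [phi] on a
    small ball, and enlarging that ball gives boundedness; conversely,
    boundedness bounds [phi] on the unit ball, and shrinking that ball makes
    the values as small as desired. *)

Set Implicit Arguments.
Unset Strict Implicit.
Unset Printing Implicit Defensive.

Import GRing.Theory numFieldNormedType.Exports.
Import Order.TTheory Num.Theory.
Local Open Scope classical_set_scope.
Local Open Scope ring_scope.

Lemma bounded_setP (R : realType) (V : normedModType R) (A : set V) :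
  bounded_set A <-> exists2 M : R, 0 < M & forall x, A x -> `|x| <= M.
Proof.
split=> [|[M M_gt0 AM]].
  by move=> /ex_strict_bound_gt0[M M_gt0 AM]; exists M => // x /AM /ltW.
by exists M; split=> [|x /ltW Mx y /AM /le_trans]; [exact: num_real|apply].
Qed.

(** A point [y] of [phi 0] has its dilates [l^-1 *: y] in [phi 0] as well, so
    that [`|y| <= l * M] for all [l > 0] when [M] bounds [phi 0]. *)
Lemma homogeneous_at0 (R : realType) (X Y : normedModType R)
    (phi : X -> set Y) :
  (forall l : R, 0 < l -> phi (l *: 0) = [set l *: u | u in phi 0]) ->
  bounded_set (phi 0) -> phi 0 `<=` [set 0].
Proof.
move=> phiZ /bounded_setP[M M_gt0 phi0M] y phi0y.
apply/eqP; rewrite -normr_le0; apply/ler_addgt0Pr => e e_gt0; rewrite add0r.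
have l_gt0 : 0 < e / M by rewrite divr_gt0.
move: phi0y; rewrite -(scaler0 _ (e / M)) phiZ// => -[u /phi0M uM <-].
by rewrite normrZ gtr0_norm// mulrAC ler_pdivrMr// ler_pM2l.
Qed.

(** Both directions of the theorem are instances of this rescaling.  The point
    [k^-1 *: x] of the cone lies in the ball of radius [d], and the values of
    [phi] at [x] are [k] times its values there. *)
Lemma homogeneous_bound (R : realType) (X Y : normedModType R) (C : set X)
    (phi : X -> set Y) (d m : R) :
  cone C ->
  (forall (x : X) (l : R), C x -> 0 < l ->
     phi (l *: x) = [set l *: u | u in phi x]) ->
  (forall z, C z -> `|z| <= d -> forall y, phi z y -> `|y| <= m) ->
  forall (k : R) x, 0 < k -> C x -> `|x| <= k * d ->
  forall y, phi x y -> `|y| <= k * m.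
Proof.
move=> C_cone phiZ phi_dm k x k_gt0 Cx x_kd y.
have Cz : C (k^-1 *: x) by apply: (C_cone k^-1); [rewrite invr_gt0|exists x].
have zd : `|k^-1 *: x| <= d.
  by rewrite normrZ gtr0_norm ?invr_gt0// ler_pdivrMl.
rewrite -[x in phi x](scalerKV (lt0r_neq0 k_gt0)) phiZ// => -[u phizu <-].
by rewrite normrZ gtr0_norm// ler_pM2l// (phi_dm _ Cz zd).
Qed.

Theorem lemma2 (R : realType) (X Y : normedModType R) (C : set X)
    (phi : X -> set Y)
    (C_cone : cone C) (C_convex : convex_set C) (C_0 : C 0)
    (phi_corr : correspondence C phi) (phi_sublinear : sublinear C phi)
    (phi_bounded_values : forall x, C x -> bounded_set (phi x)) :
  upper_semicontinuous_at C phi 0 <-> bounded_correspondence C phi.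
Proof.
have phiZ := phi_sublinear.2.
have phi0 : phi 0 `<=` [set 0].
  by apply: homogeneous_at0 => [l|]; [exact: phiZ|exact: phi_bounded_values].
split=> [phi_usc E EC /bounded_setP[M M_gt0 EM]|phi_bnd U [V [oV phi0V VU]]].
- have : \forall z \near within C (nbhs 0), phi z `<=` ball (0 : Y) 1.
    apply: phi_usc; exists (ball 0 1); split=> //; first exact: ball_open.
    by move=> y /phi0 ->; exact: ballxx.
  rewrite near_withinE => /nbhs_closedballP[d /= dP].
  have d_gt0 : 0 < d%:num by [].
  apply/bounded_setP; exists (M / d%:num * 1) => [|y [x Ex phixy]].
    by rewrite mulr1 divr_gt0.
  apply: (homogeneous_bound (d := d%:num) C_cone phiZ _ _ (EC _ Ex) _ phixy).
  + move=> z Cz zd w phizw.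
    have : ball (0 : Y) 1 w.
      apply: (dP z) => //.
      by rewrite closed_ballE// /closed_ball_/= sub0r normrN.
    by rewrite -ball_normE /= sub0r normrN => /ltW.
  + by rewrite divr_gt0.
  + by rewrite divfK ?gt_eqF// EM.
- have [y0 phi0y0] := phi_corr _ C_0.
  have V0 : V 0 by have := phi0V _ phi0y0; rewrite (phi0 _ phi0y0).
  have /nbhs_closedballP[e eV] : nbhs (0 : Y) V by exact: open_nbhs_nbhs.
  have /bounded_setP[M M_gt0 phiM] :
      bounded_set (\bigcup_(x in C `&` [set x | `|x| <= 1]) phi x).
    apply: phi_bnd; first by move=> x [].
    by apply/bounded_setP; exists 1 => // x [].
  (* Shrinking the unit ball by e / M turns the bound M into e. *)
  have k_gt0 : 0 < e%:num / M by rewrite divr_gt0.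
  rewrite near_withinE; apply/nbhs_closedballP.
  exists (PosNum k_gt0) => z /=.
  rewrite closed_ballE// /closed_ball_/= sub0r normrN.
  move=> zk Cz y phizy; apply/VU/eV.
  rewrite closed_ballE// /closed_ball_/= sub0r normrN.
  rewrite -[leRHS](divfK (lt0r_neq0 M_gt0)).
  apply: (homogeneous_bound (d := 1) C_cone phiZ _ k_gt0 Cz _ phizy).
  + by move=> x Cx x1 w phixw; apply: phiM; exists x.
  + by rewrite mulr1.
Qed.
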